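(* Let $(X,T)$ be a topological dynamical system and let $\mathrm{scl}=\{\mathrm{scl}_\alpha\}_{\alpha\ge 0}$ be a scaling. For every non-empty compact subset $K\subset X$, $$h^{B}_{\mathrm{scl}}(T,K)\ \ge\ \sup\{\underline h_{\mu,\mathrm{scl}}(T):\ \mu\in\mathscr M(X),\ \mu(K)=1\}.$$ Moreover, suppose that $\mathrm{scl}$ satisfies the following controlled decay condition: for every $\alpha\ge 0$ and every sufficiently small $\delta>0$ there exist a function $f_\delta:\mathbb N\to\mathbb R_+$, a strictly increasing sequence of positive integers $\{n_k\}_{k\ge1}$, and a constant $C_{\alpha,\delta}\ge1$ such that (1) $\displaystyle\lim_{\delta\to0}\limsup_{k\to\infty}\frac{f_\delta(n_k)\,\mathrm{scl}_{\alpha+\delta}(e^{-n_k})}{\mathrm{scl}_\alpha(e^{-n_k})}<\infty$; (2) $\displaystyle\sum_{k=1}^\infty \frac1{f_\delta(n_k)}<\infty$; (3) $\displaystyle\frac{\mathrm{scl}_\alpha(e^{-n_k})}{\mathrm{scl}_\alpha(e^{-n_{k+1}})}\le C_{\alpha,\delta}$ for all $k$. Then for every non-empty compact subset $K\subset X$, $$h^{B}_{\mathrm{scl}}(T,K)=\sup\{\underline h_{\mu,\mathrm{scl}}(T):\ \mu\in\mathscr M(X),\ \mu(K)=1\}.$$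
   Context: A topological dynamical system $(X,T)$ consists of a compact metric space $(X,d)$ and a continuous map $T:X\to X$. $\mathscr M(X)$ is the set of Borel probability measures on $X$; $\mathbb N=\{1,2,\dots\}$. Put $d_n(x,y)=\max_{0\le j<n}d(T^jx,T^jy)$ and $B_n(x,\epsilon)=\{y\in X: d_n(x,y)<\epsilon\}$. A scaling is a family $\mathrm{scl}=(\mathrm{scl}_\alpha)_{\alpha\ge0}$ of positive non-decreasing functions on $(0,1)$ such that for all $\alpha>\beta>0$ and every $\lambda>1$ sufficiently close to $1$, $\mathrm{scl}_\alpha(\epsilon)=o(\mathrm{scl}_\beta(\epsilon^\lambda))$ and $\mathrm{scl}_\alpha(\epsilon)=o(\mathrm{scl}_\beta(\epsilon)^\lambda)$ as $\epsilon\to0^+$. Bowen entropy scale: for non-empty $K\subset X$, $M_{\mathrm{scl}_\alpha}(T,K,\epsilon,N)=\inf\sum_{i\in I}\mathrm{scl}_\alpha(e^{-n_i})$, the infimum over finite or countable covers $\{B_{n_i}(x_i,\epsilon)\}_{i\in I}$ of $K$ with $n_i\ge N$, $x_i\in X$; $M_{\mathrm{scl}_\alpha}(T,K,\epsilon)=\lim_{N\to\infty}M_{\mathrm{scl}_\alpha}(T,K,\epsilon,N)$; $M_{\mathrm{scl}_\alpha}(T,K)=\lim_{\epsilon\to0}M_{\mathrm{scl}_\alpha}(T,K,\epsilon)$. Then $h^B_{\mathrm{scl}}(T,K)=\sup\{\alpha>0:M_{\mathrm{scl}_\alpha}(T,K)=\infty\}=\inf\{\alpha>0:M_{\mathrm{scl}_\alpha}(T,K)=0\}$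 (the two agree; $\sup\emptyset=0$, $\inf\emptyset=+\infty$). Lower local and measure-theoretic entropy scale: for $\mu\in\mathscr M(X)$, $\underline h_{\mu,\mathrm{scl}_\alpha}(T,x,\epsilon)=\liminf_{n\to\infty}\frac{\mathrm{scl}_\alpha(e^{-n})}{\mu(B_n(x,\epsilon))}$, where the quotient is $+\infty$ if $\mu(B_n(x,\epsilon))=0$; $\underline h_{\mu,\mathrm{scl}}(T,x,\epsilon)=\inf\{\alpha>0:\underline h_{\mu,\mathrm{scl}_\alpha}(T,x,\epsilon)=0\}=\sup\{\alpha>0:\underline h_{\mu,\mathrm{scl}_\alpha}(T,x,\epsilon)=\infty\}$ (same conventions); $\underline h_{\mu,\mathrm{scl}}(T,x)=\lim_{\epsilon\to0}\underline h_{\mu,\mathrm{scl}}(T,x,\epsilon)$ (a measurable function of $x$); $\underline h_{\mu,\mathrm{scl}}(T)=\int\underline h_{\mu,\mathrm{scl}}(T,x)\,d\mu(x)$. *)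

(* Defs.v *)
From HB Require Import structures.
From mathcomp Require Import all_boot all_order all_algebra.
From mathcomp Require Import all_classical all_reals all_analysis.

Set Implicit Arguments.
Unset Strict Implicit.
Unset Printing Implicit Defensive.

Import Order.TTheory GRing.Theory Num.Theory.
Import numFieldNormedType.Exports.

Local Open Scope classical_set_scope.
Local Open Scope ring_scope.

(* The base point is required by [measurableType]; it only excludes the empty
   space. *)
#[short(type="pmetricType")]
HB.structure Definition PointedMetric (R : numDomainType) :=
  {M of Metric R M & Pointed M}.

Notation borel X := (g_sigma_algebraType (@open X)).

(* [scl a] is only meaningful for [0 <= a] and on the open interval (0, 1);
   its values elsewhere (such as at [expR (- 0)]) affect nothing below. *)
Definition is_scaling {R : realType} (scl : R -> R -> R) : Prop :=
  [/\ forall a e : R, 0 <= a -> e \in `]0, 1[ -> 0 < scl a e,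
      forall a : R, 0 <= a -> {in `]0, 1[ &, {homo scl a : x y / x <= y}}
    & forall a b : R, 0 < b -> b < a ->
        \forall l \near 1^'+,
          (scl a : R -> R^o) =o_ (0^'+) (fun e => scl b (e `^ l) : R^o) /\
          (scl a : R -> R^o) =o_ (0^'+) (fun e => scl b e `^ l : R^o)].

Section entropy_scales.
Context {R : realType} {X : pmetricType R}.
Variables (T : X -> X) (scl : R -> R -> R).
Implicit Types (K : set X) (mu : probability (borel X) R).

Definition dist_n (n : nat) (x y : X) : R :=
  \big[Num.max/0]_(j < n) mdist (iter j T x) (iter j T y).

Definition ball_n (n : nat) (x : X) (eps : R) : set X :=
  [set y | dist_n n x y < eps].

Definition scl_exp (a : R) (n : nat) : R := scl a (expR (- n%:R)).

Local Open Scope ereal_scope.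

(* A finite or countable family of balls is indexed by a set [I] of naturals. *)
Definition bowen_cover K (eps : R) (N : nat)
    (I : set nat) (n : nat -> nat) (x : nat -> X) : Prop :=
  (forall i, I i -> (0 < n i)%N && (N <= n i)%N) /\
  K `<=` \bigcup_(i in I) ball_n (n i) (x i) eps.

Definition bowen_M_eps_N (a : R) K (eps : R) (N : nat) : \bar R :=
  ereal_inf [set s | exists I n x, bowen_cover K eps N I n x /\
                       s = \esum_(i in I) (scl_exp a (n i))%:E].

Definition bowen_M_eps (a : R) K (eps : R) : \bar R :=
  limn (bowen_M_eps_N a K eps).

Definition bowen_M (a : R) K : \bar R :=
  lim (bowen_M_eps a K eps @[eps --> 0^'+]).

(* The critical value, in its infimum form: [ereal_inf set0] is [+oo]. *)
Definition bowen_entropy K : \bar R :=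
  ereal_inf [set a%:E | a in [set a : R | (0 < a)%R /\ bowen_M a K = 0]].

(* In [\bar R], [0^-1] is [+oo], so the quotient is [+oo] on null balls. *)
Definition lower_local_eps_at mu (a : R) (x : X) (eps : R) : \bar R :=
  limn_einf (fun n => (scl_exp a n)%:E / mu (ball_n n x eps)).

Definition lower_local_eps mu (x : X) (eps : R) : \bar R :=
  ereal_inf [set a%:E | a in
    [set a : R | (0 < a)%R /\ lower_local_eps_at mu a x eps = 0]].

Definition lower_local mu (x : X) : \bar R :=
  lim (lower_local_eps mu x eps @[eps --> 0^'+]).

Definition lower_entropy mu : \bar R :=
  \int[mu]_x lower_local mu x.

Definition sup_lower_entropy K : \bar R :=
  ereal_sup [set lower_entropy mu | mu in
    [set mu : probability (borel X) R | mu K = 1]].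

End entropy_scales.

(* As the final limit relates different values of [d], the data obtained for each
   small [d] form families indexed by [d]; they may also depend on [a].
   Only the values of [f d] at positive integers matter. *)
Definition controlled_decay {R : realType} (scl : R -> R -> R) : Prop :=
  forall a : R, 0 <= a ->
  exists (f : R -> nat -> R) (n : R -> nat -> nat) (C : R -> R),
    (\forall d \near 0^'+,
      [/\ forall m, (0 < m)%N -> 0 < f d m,
          forall k, (0 < n d k)%N && (n d k < n d k.+1)%N,
          1 <= C d,
          (\sum_(0 <= k <oo) ((f d (n d k))^-1)%:E < +oo)%E
        & forall k, scl_exp scl a (n d k) / scl_exp scl a (n d k.+1) <= C d]) /\
    let L d := limn_esup (fun k =>
      (f d (n d k) * scl_exp scl (a + d) (n d k) / scl_exp scl a (n d k))%:E) in
    cvg (L d @[d --> 0^'+]) /\ (lim (L d @[d --> 0^'+]) < +oo)%E.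

(* Main.v *)
(* The inequality [>=] is the mass distribution principle: where the lower local
   entropy exceeds [a], the mass of dynamical balls is [O(scl_a)], so a set of
   points on which this holds uniformly is null as soon as [M_{scl_a} = 0].
   Conversely, let [a < a + d < h^B(K)]. Weighted covers of [K] by balls of the
   levels [n_k], at cost [scl_a], can be turned into ordinary covers at cost
   [scl_{a+d}]: by (2) some level [k] carries weight at least
   [const / f_d(n_k)] at each point, and maximal separated sets select few balls
   of that level. Hence weighted covers have cost bounded below. By the
   Hahn-Banach theorem there is then a finitely additive probability on all
   subsets of [X], carried by [K], giving each such ball a mass [O(scl_a)].
   Its regularization from inside by closed sets and from outside by open sets
   is a Borel probability, and it does not charge open balls more. *)

From HB Require Import structures.
Require Import Defs.
From mathcomp Require Import all_boot all_order all_algebra.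
From mathcomp Require Import all_classical all_reals all_analysis.
From mathcomp Require Import ring lra.
Import Order.TTheory GRing.Theory Num.Theory.
Import numFieldNormedType.Exports.
Import HBNNSimple.
Local Open Scope classical_set_scope.
Local Open Scope ring_scope.

Set Implicit Arguments.
Unset Strict Implicit.
Unset Printing Implicit Defensive.

(** * Additive minorants of sublinear functionals *)

Section sublinear.
Context {R : realType} {V : lmodType R}.
Implicit Types (D : set V) (p q : V -> R) (x y : V).

Definition linear_subspace D :=
  forall (t : R) x y, D x -> D y -> D (x + t *: y).

(** For [t > 0], using the inequality at [t^-1] as well gives equality; [t = 0] gives [q 0 <= 0].
    The relativization to [D] serves [least_cost], which is studied on functions bounded on [K]. *)
Definition sublinear_on D q :=
  (forall x y, D x -> D y -> q (x + y) <= q x + q y) /\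
  (forall t x, 0 <= t -> D x -> q (t *: x) <= t * q x).

Lemma subspaceZ D t x : linear_subspace D -> D x -> D (t *: x).
Proof.
move=> sD Dx; have := sD (t - 1) x x Dx Dx.
by rewrite scalerBl scale1r addrC subrK.
Qed.

Lemma subspaceD D x y : linear_subspace D -> D x -> D y -> D (x + y).
Proof. by move=> sD Dx Dy; rewrite -[y]scale1r; exact: sD. Qed.

Lemma subspaceN D x : linear_subspace D -> D x -> D (- x).
Proof. by move=> sD Dx; rewrite -scaleN1r; exact: subspaceZ. Qed.

Lemma sublinearN D q x : linear_subspace D -> sublinear_on D q -> D x ->
  - q (- x) <= q x.
Proof.
move=> sD [qD qZ] Dx; rewrite -subr_ge0 opprK.
have q0 : q 0 <= 0 by have := qZ 0 x (lexx _) Dx; rewrite scale0r mul0r.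
have D0 : D 0 by rewrite -(subrr x); apply: subspaceD => //; exact: subspaceN.
have : q 0 <= q 0 + q 0 by rewrite -{1}[0]addr0; exact: qD.
have := qD x (- x) Dx (subspaceN sD Dx); rewrite subrr; lra.
Qed.

(* The largest sublinear functional [r <= q] with [r (- y) <= - q y]. *)
Definition tilt q y x : R := inf [set q (x + t *: y) - t * q y | t in [set t | 0 <= t]].

Section tilt.
Variables (D : set V) (q : V -> R) (y : V).
Hypotheses (sD : linear_subspace D) (sq : sublinear_on D q) (Dy : D y).

Lemma tilt_lb x t : D x -> 0 <= t -> - q (- x) <= q (x + t *: y) - t * q y.
Proof.
move=> Dx; have [qD qZ] := sq; rewrite le_eqVlt => /predU1P[<-|t0].
  by rewrite scale0r mul0r subr0 addr0; exact: (sublinearN sD).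
have Dty := subspaceZ t sD Dy.
have : t * q y <= q (t *: y).
  have := qZ t^-1 (t *: y); rewrite invr_ge0 (ltW t0) scalerA mulVf ?gt_eqF// scale1r.
  by move=> /(_ isT Dty); rewrite mulrC ler_pdivlMr// mulrC.
have := qD (x + t *: y) (- x) (subspaceD sD Dx Dty) (subspaceN sD Dx).
rewrite addrAC subrr add0r; lra.
Qed.

Lemma tilt_le x t : D x -> 0 <= t -> tilt q y x <= q (x + t *: y) - t * q y.
Proof.
move=> Dx t0; apply: ge_inf; last by exists t.
by exists (- q (- x)) => _ [s s0 <-]; exact: tilt_lb.
Qed.

Lemma le_tilt x c :
  (forall t, 0 <= t -> c <= q (x + t *: y) - t * q y) -> c <= tilt q y x.
Proof.
move=> h; apply: lb_le_inf; first by exists (q (x + 0 *: y) - 0 * q y), 0 => /=.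
by move=> _ [t t0 <-]; exact: h.
Qed.

Lemma tilt_le_self x : D x -> tilt q y x <= q x.
Proof. by move=> /tilt_le/(_ (lexx 0)); rewrite scale0r mul0r addr0 subr0. Qed.

(** Parameters [t] for [u] and [s] for [v] combine into [t + s] for [u + v]; scaling [x] by [t]
    scales the parameter by [t]. *)
Lemma tilt_sublinear : sublinear_on D (tilt q y).
Proof.
have [qD qZ] := sq; split=> [u v Du Dv|t x].
  rewrite -lerBlDl; apply: le_tilt => s s0; rewrite lerBlDl -lerBlDr.
  apply: le_tilt => t t0; rewrite lerBlDr.
  apply: (le_trans (tilt_le (t := t + s) _ _)); first exact: subspaceD.
    exact: addr_ge0.
  rewrite scalerDl addrACA.
  have := qD (u + t *: y) (v + s *: y) (sD _ Du Dy) (sD _ Dv Dy); lra.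
rewrite le_eqVlt => /predU1P[<-|t0] Dx.
  rewrite scale0r mul0r; apply: (le_trans (tilt_le_self _)).
    by rewrite -(scale0r x); exact: subspaceZ.
  by have := qZ 0 x (lexx _) Dx; rewrite scale0r mul0r.
rewrite mulrC -ler_pdivrMr//; apply: le_tilt => s s0; rewrite ler_pdivrMr//.
apply: (le_trans (tilt_le (t := t * s) (subspaceZ _ sD Dx) _)).
  by rewrite mulr_ge0// ltW.
rewrite -scalerA -scalerDr mulrBl [X in _ <= X - _]mulrC.
have := qZ t (x + s *: y) (ltW t0) (sD _ Dx Dy).
by rewrite [s * _ * t]mulrAC [s * t]mulrC; lra.
Qed.

End tilt.

(* A minimal sublinear functional is not decreased by tilting in any
   direction, hence is superadditive. Starting the minimization from a tilt of
   [p] in the direction [y] forces equality at [y]. *)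
Lemma dominated_additive D p y : linear_subspace D -> sublinear_on D p -> D y ->
  exists L : V -> R,
    [/\ forall u v, D u -> D v -> L (u + v) = L u + L v,
        forall x, D x -> L x <= p x & L y = p y].
Proof.
move=> sD sp Dy.
pose T := {q : V -> R | sublinear_on D q /\ forall x, D x -> q x <= tilt p y x}.
pose q0 : T := exist _ (tilt p y)
  (conj (tilt_sublinear sD sp Dy) (fun x _ => lexx _)).
(* The order is reversed, so that a maximal element for Zorn's lemma is a minimal sublinear
   functional. *)
pose le (q r : T) := `[< forall x, D x -> sval r x <= sval q x >].
have [||A Atot|[q [sq qp]] qmin] := @ZL_preorder T q0 le.
- by move=> q; apply/asboolP.
- move=> r s t /asboolP rs /asboolP st; apply/asboolP => x Dx.
  exact: le_trans (st _ Dx) (rs _ Dx).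
- have [[r0 Ar0]|A0] := pselect (A !=set0); last first.
    by exists q0 => s As; exfalso; apply: A0; exists s.
  pose g x := inf [set sval r x | r in A].
  have g_le x r : D x -> A r -> g x <= sval r x.
    move=> Dx Ar; apply: ge_inf; last by exists r.
    exists (- tilt p y (- x)) => _ [s As <-].
    have [ss sp'] := svalP s.
    apply: le_trans (sublinearN sD ss Dx).
    by rewrite lerN2; apply: sp'; exact: subspaceN.
  have le_g x c : (forall r, A r -> c <= sval r x) -> c <= g x.
    move=> h; apply: lb_le_inf; first by exists (sval r0 x), r0.
    by move=> _ [r Ar <-]; exact: h.
  have sg : sublinear_on D g /\ forall x, D x -> g x <= tilt p y x.
    split; last first.
      move=> x Dx; apply: (le_trans (g_le _ _ Dx Ar0)).
      by case: (svalP r0) => _; exact.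
    split=> [u v Du Dv|t x t0 Dx].
      rewrite -lerBlDl; apply: (le_g) => r Ar; rewrite lerBlDl -lerBlDr.
      apply: (le_g) => s As; rewrite lerBlDr.
      (* In a chain, the smaller of the two functionals can serve for both vectors. *)
      wlog rs : r s Ar As / forall x, D x -> sval r x <= sval s x.
        move=> h; have [/asboolP rs|/asboolP sr] := Atot _ _ Ar As; last exact: h.
        have [[rD _] _] := svalP s.
        apply: (le_trans (g_le _ _ (subspaceD sD Du Dv) As)).
        apply: (le_trans (rD _ _ Du Dv)).
        by rewrite lerD2l; exact: rs.
      have [[rD _] _] := svalP r.
      apply: (le_trans (g_le _ _ (subspaceD sD Du Dv) Ar)).
      apply: (le_trans (rD _ _ Du Dv)).
      by rewrite lerD2r; exact: rs.
    move: t0; rewrite le_eqVlt => /predU1P[<-|t0].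
      rewrite scale0r mul0r; have [[_ rZ] _] := svalP r0.
      apply: (le_trans (g_le _ r0 _ Ar0)).
        by rewrite -(scale0r x); exact: subspaceZ.
      by have := rZ 0 x (lexx _) Dx; rewrite scale0r mul0r.
    rewrite mulrC -ler_pdivrMr//; apply: (le_g) => r Ar; rewrite ler_pdivrMr//.
    have [[_ rZ] _] := svalP r.
    apply: (le_trans (g_le _ _ (subspaceZ _ sD Dx) Ar)).
    by rewrite mulrC; apply: rZ => //; exact: ltW.
  exists (exist _ g sg) => s As; apply/asboolP => x Dx /=; exact: g_le.
(* [tilt q v] is an admissible functional below [q], so minimality gives [q <= tilt q v]; the
   parameter 1 at [u] then yields superadditivity. *)
have superadd u v : D u -> D v -> q u + q v <= q (u + v).
  move=> Du Dv.
  pose r : T := exist _ (tilt q v) (conj (tilt_sublinear sD sq Dv)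
    (fun x Dx => le_trans (tilt_le_self sD sq Dv Dx) (qp _ Dx))).
  have /qmin/asboolP : le (exist _ q (conj sq qp)) r.
    by apply/asboolP => x Dx /=; exact: tilt_le_self Dx.
  move=> /(_ u Du)/= /le_trans/(_ (tilt_le sD sq Dv Du ler01)).
  by rewrite scale1r mul1r -lerBrDr.
have addq u v : D u -> D v -> q (u + v) = q u + q v.
  by move=> Du Dv; apply/eqP; rewrite eq_le superadd// andbT; apply: sq.1.
have q_le x : D x -> q x <= p x.
  move=> Dx; apply: le_trans (qp _ Dx) _; exact: tilt_le_self Dx.
exists q; split => //; apply/eqP; rewrite eq_le q_le//=.
have DNy := subspaceN sD Dy.
have q00 : q (y - y) = q y + q (- y) by exact: addq.
have q0_ge : 0 <= q (y - y).
  by have := addq (y - y) (y - y) (subspaceD sD Dy DNy) (subspaceD sD Dy DNy);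
     rewrite subrr addr0; lra.
(* The parameter 1 in the tilt gives [q (- y) <= p 0 - p y <= - p y], while [q y + q (- y) >= 0]. *)
have := qp _ DNy; have := tilt_le sD sp Dy DNy ler01.
rewrite scale1r mul1r addNr.
have : p 0 <= 0 by have := sp.2 0 y (lexx _) Dy; rewrite scale0r mul0r.
lra.
Qed.

End sublinear.

(** * Borel probabilities from finitely additive ones *)

Section borel_of_content.
Context {R : realType} {X : ptopologicalType}.
Hypotheses (cX : compact [set: X]) (hX : hausdorff_space X).
Variable lam : set X -> R.
Hypotheses (lam_ge0 : forall A, 0 <= lam A)
  (lamU : forall A B, A `&` B = set0 -> lam (A `|` B) = lam A + lam B)
  (lamT : lam setT = 1).
Local Open Scope ereal_scope.

Let lam_le A B : A `<=` B -> (lam A <= lam B)%R.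
Proof.
by move=> AB; rewrite -(setDUK AB) lamU ?setDIK// lerDl.
Qed.

Let lam0 : lam set0 = 0%R.
Proof. by have := lamU (set0I set0); rewrite setU0; lra. Qed.

Let lam_leU A B : (lam (A `|` B) <= lam A + lam B)%R.
Proof.
rewrite -(setDUK (@subsetUl _ A B)).
by rewrite lamU ?setDIK// lerD2l; apply: lam_le => x [[]].
Qed.

Definition inner_content (U : set X) : \bar R :=
  ereal_sup [set (lam F)%:E | F in [set F | closed F /\ F `<=` U]].

Definition outer_content (A : set X) : \bar R :=
  ereal_inf [set inner_content U | U in [set U | open U /\ A `<=` U]].

Let inner_ge F U : closed F -> F `<=` U -> (lam F)%:E <= inner_content U.
Proof. by move=> cF FU; apply: ereal_sup_ubound; exists F. Qed.

Let inner_le U : inner_content U <= (lam U)%:E.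
Proof. by apply: ge_ereal_sup => _ [F [_ FU] <-]; rewrite lee_fin lam_le. Qed.

Let inner_ge0 U : 0 <= inner_content U.
Proof. by rewrite -[0]/(0%R%:E) -lam0; apply: inner_ge => //; exact: closed0. Qed.

Let inner_homo U V : U `<=` V -> inner_content U <= inner_content V.
Proof.
move=> UV; apply: ge_ereal_sup => _ [F [cF FU] <-].
by apply: inner_ge => //; exact: subset_trans UV.
Qed.

(** Induction on [n]. By normality, [F] minus [U n] has an open neighbourhood [V] contained in some
    [W] whose closure lies in the union of the first [n] sets. Then [F] splits into its part in that
    closure and its part outside [V], which lies in [U n]. *)
Let inner_subadd F (U : (set X)^nat) n : closed F -> (forall i, open (U i)) ->
  F `<=` \bigcup_(i < n) U i -> (lam F)%:E <= \sum_(i < n) inner_content (U i).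
Proof.
move=> + oU; elim: n F => [|n IH] F cF.
  by rewrite bigcup_mkord !big_ord0 subset0 => ->; rewrite lam0.
rewrite big_ord_recr/= => FU.
have cFU : closed (F `\` U n) by apply: closedI => //; exact: open_closedC.
have : set_nbhs (F `\` U n) (\bigcup_(i < n) U i).
  apply/set_nbhsP; exists (\bigcup_(i < n) U i); split => //.
    by apply: bigcup_open => i _; exact: oU.
  move=> x [Fx nUx]; have [i /=] := FU x Fx.
  rewrite ltnS leq_eqVlt => /predU1P[->//|ilt] Uix.
  by exists i.
move/(compact_normal hX cX cFU) => [W /set_nbhsP[V [oV FV VW]] cW].
have cF1 : closed (F `&` closure W) by apply: closedI => //; exact: closed_closure.
have cF2 : closed (F `\` V) by apply: closedI => //; exact: open_closedC.
have F12 : F `<=` (F `&` closure W) `|` (F `\` V).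
  move=> x Fx; have [Vx|nVx] := pselect (V x); last by right.
  by left; split => //; apply: subset_closure; exact: VW.
apply: (@le_trans _ _ ((lam (F `&` closure W))%:E + (lam (F `\` V))%:E)).
  by rewrite -EFinD lee_fin; apply: le_trans (lam_le F12) _; exact: lam_leU.
apply: leeD; first by apply: IH => // x [_ /cW].
apply: inner_ge => // x [Fx nVx]; apply: contrapT => nUx.
by apply: nVx; apply: FV.
Qed.

(** A closed [F] inside the union is compact, hence meets the case of finitely many [U i]. *)
Let inner_bigcup (U : (set X)^nat) : (forall i, open (U i)) ->
  inner_content (\bigcup_i U i) <= \sum_(i <oo) inner_content (U i).
Proof.
move=> oU; apply: ge_ereal_sup => _ [F [cF FU] <-].
have /(subclosed_compact cF cX) : F `<=` setT by [].
rewrite compact_cover => /(_ nat setT U (fun i _ => oU i) FU)[D _ FD].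
pose n := (\max_(i <- finmap.enum_fset D) i).+1.
apply: le_trans (nneseries_lim_ge n _) => //; rewrite big_mkord.
apply: inner_subadd => // x /FD[i /= iD Uix]; exists i => //=.
by rewrite ltnS; apply: (@leq_bigmax_seq _ _ _ id).
Qed.

Let outer_le U A : open U -> A `<=` U -> outer_content A <= inner_content U.
Proof. by move=> oU AU; apply: ereal_inf_lbound; exists U. Qed.

Let le_outer c A :
  (forall U, open U -> A `<=` U -> c <= inner_content U) -> c <= outer_content A.
Proof. by move=> h; apply: le_ereal_inf_tmp => _ [U [oU AU] <-]; exact: h. Qed.

Let outer_open U : open U -> outer_content U = inner_content U.
Proof.
move=> oU; apply/eqP; rewrite eq_le outer_le//=; apply: le_outer => V _ UV.
exact: inner_homo.
Qed.

Let outer_ge0 A : 0 <= outer_content A.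
Proof. exact: le_outer. Qed.

Let outer0 : outer_content set0 = 0.
Proof.
rewrite outer_open; last exact: open0.
by apply/eqP; rewrite eq_le inner_ge0 andbT -[leRHS]/(0%R%:E) -lam0; exact: inner_le.
Qed.

Let outer_homo : {homo outer_content : A B / A `<=` B >-> A <= B}.
Proof.
move=> A B AB; apply: le_outer => U oU BU; apply: outer_le => //.
exact: subset_trans BU.
Qed.

Let outer_fin A : outer_content A \is a fin_num.
Proof.
rewrite ge0_fin_numE//; apply: (@le_lt_trans _ _ (lam setT)%:E); last by rewrite ltry.
apply: le_trans (inner_le _); apply: outer_le => //; exact: openT.
Qed.

Let outer_near A (e : R) : (0 < e)%R ->
  exists U, [/\ open U, A `<=` U & inner_content U <= outer_content A + e%:E].
Proof.
move=> e0; have [_ [U [oU AU] <-] /ltW h] := lb_ereal_inf_adherent e0 (outer_fin A).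
by exists U.
Qed.

Let outer_sigma_subadditive : sigma_subadditive outer_content.
Proof.
move=> A; apply/lee_addgt0Pr => e e0.
have e20 i : (0 < e / (2 ^ i.+1)%:R)%R by rewrite divr_gt0// ltr0n expn_gt0.
have /choice[U hU] i := outer_near (A i) (e20 i).
apply: (@le_trans _ _ (\sum_(i <oo) inner_content (U i))).
  apply: le_trans (inner_bigcup _); last by move=> i; case: (hU i).
  apply: outer_le; first by apply: bigcup_open => i _; case: (hU i).
  by apply: subset_bigcup => i _; case: (hU i).
apply: le_trans (epsilon_trick xpredT (fun n => outer_ge0 (A n)) (ltW e0)).
by apply: lee_nneseries => // i _; case: (hU i).
Qed.

HB.instance Definition _ := isOuterMeasure.Build R X outer_content
  outer0 outer_ge0 outer_homo outer_sigma_subadditive.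

(** A closed [F] inside both [U] and [V] and a closed [G] inside [U] minus [F] are disjoint, so
    [lam F + lam G] is at most the inner content of [U]. Suprema over [G] and [F] then split [U]
    along [V]. *)
Let open_caratheodory V : open V -> outer_content.-caratheodory V.
Proof.
move=> oV; apply: (@le_caratheodory_measurable _ _ outer_content) => A.
apply: le_outer => U oU AU.
have oUV := openI oU oV.
apply: (@le_trans _ _ (inner_content (U `&` V) + outer_content (A `&` ~` V))).
  by rewrite leeD2r//; apply: outer_le => //; exact: setSI.
rewrite -leeBrDr//; apply: ge_ereal_sup => _ [F [cF FUV] <-].
have oUF : open (U `\` F) by apply: openI => //; exact: closed_openC.
rewrite leeBrDr// addeC -leeBrDr//.
apply: (@le_trans _ _ (inner_content (U `\` F))).
  apply: outer_le => // x [Ax nVx]; split; first exact: AU.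
  by move=> /FUV[].
apply: ge_ereal_sup => _ [G [cG GU] <-]; rewrite leeBrDr// -EFinD.
rewrite -lamU; last first.
  by rewrite -subset0 => x [/GU[]].
apply: inner_ge; first exact: closedU.
by move=> x [/GU[]//|/FUV[]].
Qed.

Let borel_caratheodory (A : set (borel X)) :
  measurable A -> outer_content.-caratheodory (A : set X).
Proof.
(* A Borel set belongs to every sigma-algebra containing the open sets, in particular to the
   Caratheodory one. *)
move=> mA; apply: (mA outer_content.-caratheodory); split; last exact: open_caratheodory.
exact: (sigma_algebra_measurable (caratheodory_type outer_content)).
Qed.

Definition borel_measure (A : set (borel X)) : \bar R := outer_content A.

Let borel_sigma_additive : semi_sigma_additive borel_measure.
Proof.
move=> F mF tF mUF; apply: (@caratheodory_measure_sigma_additive _ _ outer_content) => //.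
- by move=> i; exact: borel_caratheodory.
- exact: borel_caratheodory.
Qed.

HB.instance Definition _ := isMeasure.Build _ _ _ borel_measure
  outer0 outer_ge0 borel_sigma_additive.

Let borel_measureT : borel_measure setT = 1.
Proof.
rewrite /borel_measure outer_open; last exact: openT.
apply/eqP; rewrite eq_le -[1]/(1%R%:E) -lamT inner_le/= inner_ge//; exact: closedT.
Qed.

HB.instance Definition _ := Measure_isProbability.Build _ _ _ borel_measure
  borel_measureT.

(** The bound on open sets is meant for dynamical balls, the one on closed sets for [K]. *)
Lemma borel_probability_of_content : exists mu : probability (borel X) R,
  (forall U : set X, open U -> mu U <= (lam U)%:E) /\
  (forall F : set X, closed F -> (lam F)%:E <= mu F).
Proof.
exists borel_measure; split=> [U oU|F cF]; rewrite /= /borel_measure.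
  by rewrite outer_open.
by apply: le_outer => U oU FU; exact: inner_ge.
Qed.

End borel_of_content.

(** * Weighted covers *)

Section weighted_cover.
Context {R : realType} {X : Type} {I : eqType}.
Variables (B : I -> set X) (w : I -> R).
Implicit Types (l : seq (R * I)) (f : X -> R).

(** A list of coefficients and indices is a finite weighted family; repetitions are allowed, so
    concatenation adds both weights and costs. *)
Definition nonneg_weights l := all (fun ci => 0 <= ci.1) l.

Definition total_weight l x : R := \sum_(ci <- l) ci.1 * \1_(B ci.2) x.

Definition weighted_cost l : R := \sum_(ci <- l) ci.1 * w ci.2.

Section duality.
Variable K : set X.

(** Value of a linear programme whose dual solutions are the contents sought. Given the finite cover
    [s] below, the set of costs is non-empty for [f] bounded on [K]. *)
Definition least_cost f : R :=
  inf [set weighted_cost l | l in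
    [set l | nonneg_weights l /\ forall x, K x -> f x <= total_weight l x]].

Definition bounded_fun_on : set (X -> R) :=
  [set f | exists M, forall x, K x -> `|f x| <= M].

Variables (s : seq I) (c : R).
Hypotheses (w_ge0 : forall i, 0 <= w i)
  (Ks : forall x, K x -> has (fun i => x \in B i) s)
  (c_gt0 : 0 < c)
  (c_le : forall l, nonneg_weights l ->
     (forall x, K x -> 1 <= total_weight l x) -> c <= weighted_cost l).

Let cost_ge0 l : nonneg_weights l -> 0 <= weighted_cost l.
Proof.
move=> /allP l0; rewrite /weighted_cost big_seq.
by apply: sumr_ge0 => ci cil; rewrite mulr_ge0// l0.
Qed.

Let least_cost_le f l : nonneg_weights l ->
  (forall x, K x -> f x <= total_weight l x) -> least_cost f <= weighted_cost l.
Proof.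
move=> l0 fl; apply: ge_inf; last by exists l.
by exists 0 => _ [k [k0 _] <-]; exact: cost_ge0.
Qed.

Let le_least_cost f b : bounded_fun_on f -> (forall l, nonneg_weights l ->
  (forall x, K x -> f x <= total_weight l x) -> b <= weighted_cost l) ->
  b <= least_cost f.
Proof.
move=> [M fM] h; apply: lb_le_inf; last by move=> _ [l [l0 fl] <-]; exact: h.
(* The absolute value of [M] as weight on each member of the finite cover [s] dominates [f], so the
   infimum is not over the empty set. *)
pose l := [seq (`|M|, i) | i <- s].
have l0 : nonneg_weights l by apply/allP => _ /mapP[i _ ->] /=.
exists (weighted_cost l), l => //; split=> // x Kx.
have /hasP[i is_ Bix] := Ks Kx.
apply: le_trans (le_trans (ler_norm _) (fM x Kx)) _.
rewrite /total_weight big_map (big_rem i)//= indicE Bix mulr1.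
apply: le_trans (ler_norm M) _; rewrite lerDl.
by apply: sumr_ge0 => j _; rewrite mulr_ge0.
Qed.

Let bounded_fun_on_subspace : linear_subspace bounded_fun_on.
Proof.
move=> t f g [M fM] [N gN]; exists (M + `|t| * N) => x Kx.
apply: le_trans (ler_normD _ _) _; apply: lerD; first exact: fM.
by rewrite normrM ler_wpM2l// gN.
Qed.

Let least_cost_sublinear : sublinear_on bounded_fun_on least_cost.
Proof.
split=> [f g bf bg|t f].
  rewrite -lerBlDl; apply: le_least_cost => // k k0 gk; rewrite lerBlDl -lerBlDr.
  apply: le_least_cost => // l l0 fl; rewrite lerBlDr.
  apply: le_trans (least_cost_le (l := l ++ k) _ _) _.
  - by rewrite /nonneg_weights all_cat; apply/andP; split.
  - by move=> x Kx; rewrite /total_weight big_cat; apply: lerD; [exact: fl|exact: gk].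
  - by rewrite /weighted_cost big_cat.
rewrite le_eqVlt => /predU1P[<-|t0] bf.
  rewrite mul0r scale0r; have <- : weighted_cost [::] = 0 by exact: big_nil.
  by apply: least_cost_le => // x _; rewrite /total_weight big_nil.
rewrite mulrC -ler_pdivrMr//; apply: le_least_cost => // l l0 fl.
rewrite ler_pdivrMr//; pose k := [seq (t * ci.1, ci.2) | ci <- l].
have -> : weighted_cost l * t = weighted_cost k.
  by rewrite /weighted_cost big_map mulr_suml; apply: eq_bigr => ci _ /=; ring.
apply: least_cost_le => [|x Kx].
  apply/allP => _ /mapP[ci cil ->] /=; rewrite mulr_ge0// ?(ltW t0)//.
  exact: (allP l0).
have -> : total_weight k x = t * total_weight l x.
  by rewrite /total_weight big_map mulr_sumr; apply: eq_bigr => ci _ /=; ring.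
by apply: ler_wpM2l; [exact: ltW|exact: fl].
Qed.

Let indic_bounded (A : set X) : bounded_fun_on \1_A.
Proof.
by exists 1 => x _; rewrite indicE ger0_norm// lern1 leq_b1.
Qed.

(** Duality: an additive minorant of [least_cost] that agrees with it at the constant 1, where it is
    at least [c], is evaluated on indicators and normalized. The weighted family made of [B i]
    alone, with coefficient 1, bounds [lam (B i)]. *)
Lemma content_of_weighted_cover : exists lam : set X -> R,
  [/\ forall A, 0 <= lam A,
      forall A A', A `&` A' = set0 -> lam (A `|` A') = lam A + lam A',
      lam setT = 1, lam (~` K) = 0
    & forall i, lam (B i) <= w i / c].
Proof.
have [L [LD Lp LT]] := dominated_additive bounded_fun_on_subspace
  least_cost_sublinear (indic_bounded setT).
have p_ge : c <= least_cost \1_setT.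
  by apply: le_least_cost => // l l0 h; apply: c_le => // x Kx;
     apply: le_trans (h x Kx); rewrite indicT.
set W := L \1_setT; have W0 : 0 < W by rewrite /W LT; exact: lt_le_trans p_ge.
have Wc : c <= W by rewrite /W LT.
(* The empty weighted family costs 0. This yields both positivity on indicators and the vanishing on
   the complement of [K]. *)
have L_le0 f : bounded_fun_on f -> (forall x, K x -> f x <= 0) -> L f <= 0.
  move=> bf f0; apply: le_trans (Lp _ bf) _.
  have <- : weighted_cost [::] = 0 by exact: big_nil.
  by apply: least_cost_le => // x Kx; rewrite /total_weight big_nil; exact: f0.
have b0 : bounded_fun_on 0 by exists 0 => x _; rewrite normr0.
have L0 : L 0 = 0 by have := LD 0 0 b0 b0; rewrite addr0; lra.
have L_ge0 A : 0 <= L \1_A.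
  have bN := subspaceN bounded_fun_on_subspace (indic_bounded A).
  have := LD _ _ (indic_bounded A) bN; rewrite subrr L0.
  have : L (- \1_A) <= 0 by apply: L_le0 => // x _; rewrite oppr_le0.
  lra.
exists (fun A => L \1_A / W); split=> [A|A A' AA'|||i].
- by rewrite divr_ge0// ltW.
- rewrite -mulrDl -LD//; congr (L _ / _); apply/funext => x.
  rewrite !fctE !indicE in_setU -natrD; congr (_%:R).
  case: (boolP (x \in A)) => //; case: (boolP (x \in A')) => // /set_mem xA' /set_mem xA.
  by have : (A `&` A') x by []; rewrite AA'.
- by rewrite divff// gt_eqF.
- suff -> : L \1_(~` K) = 0 by rewrite mul0r.
  apply/eqP; rewrite eq_le L_ge0 andbT; apply: L_le0 => // x Kx.
  by rewrite indicE memNset// => /(_ Kx).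
- apply: (@le_trans _ _ (w i / W)).
    rewrite ler_pM2r ?invr_gt0//; apply: le_trans (Lp _ (indic_bounded _)) _.
    have <- : weighted_cost [:: (1, i)] = w i by rewrite /weighted_cost big_seq1 mul1r.
    apply: least_cost_le => [|x _]; first by rewrite /nonneg_weights/= ler01.
    by rewrite /total_weight big_seq1 mul1r.
  by rewrite ler_wpM2l// lef_pV2.
Qed.

End duality.
End weighted_cover.

Lemma sumr_seq_const (R : nmodType) (I : Type) (s : seq I) (t : R) :
  \sum_(i <- s) t = t *+ size s.
Proof. by rewrite big_const_seq count_predT iter_addr_0. Qed.

(** * Dynamical metrics and balls *)

Section dynamical_balls.
Context {R : realType} {X : pmetricType R}.
Variable T : X -> X.

Lemma dist_n_sym n x y : dist_n T n x y = dist_n T n y x.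
Proof. by apply: eq_bigr => j _; exact: metric_sym. Qed.

Lemma dist_n_triangle n x y z : dist_n T n x z <= dist_n T n x y + dist_n T n y z.
Proof.
have le_dist_n (j : 'I_n) u v : mdist (iter j T u) (iter j T v) <= dist_n T n u v.
  exact: (@le_bigmax _ _ _ 0 (fun j : 'I_n => mdist (iter j T u) (iter j T v))).
have dist_n_ge0 u v : 0 <= dist_n T n u v by exact: bigmax_ge_id.
apply: bigmax_le => [|j _]; first exact: addr_ge0.
by apply: le_trans (metric_triangle _ (iter j T y) _) _; apply: lerD.
Qed.

Lemma dist_nxx n x : dist_n T n x x = 0.
Proof.
apply/eqP; rewrite eq_le bigmax_ge_id andbT.
by apply: bigmax_le => // j _; rewrite mdistxx.
Qed.

Lemma ball_n_center n x eps : 0 < eps -> ball_n T n x eps x.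
Proof. by rewrite /ball_n/= dist_nxx. Qed.

Lemma subset_ball_n m n x e e' : (m <= n)%N -> e <= e' ->
  ball_n T n x e `<=` ball_n T m x e'.
Proof.
move=> mn ee y; rewrite /ball_n/= => /lt_le_trans/(_ ee).
apply: le_lt_trans; rewrite /dist_n.
exact: (@le_bigmax_ord _ _ 0 m n xpredT (fun j => mdist (iter j T x) (iter j T y))).
Qed.

(** Allows recentring a ball at any of its points, at the price of doubling the radius. *)
Lemma ball_n_sub n x y e : ball_n T n x (e / 2) y ->
  ball_n T n x (e / 2) `<=` ball_n T n y e.
Proof.
rewrite /ball_n/= dist_n_sym => yx z xz.
by apply: le_lt_trans (dist_n_triangle _ _ x _) _; rewrite [ltRHS]splitr ltrD.
Qed.

Hypothesis cT : continuous T.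

Lemma ball_n_open n x eps : open (ball_n T n x eps).
Proof.
have mdist_open (z : X) : open [set y | mdist z y < eps].
  rewrite openE => y /= zy; apply/nbhs_ballP; exists (eps - mdist z y) => /=.
    by rewrite subr_gt0.
  move=> u; rewrite ballEmdist/= ltrBrDl; apply: le_lt_trans.
  exact: metric_triangle.
have cTj j : continuous (iter j T).
  elim: j => [|j IH] y; first exact: cvg_id.
  by apply: continuous_comp; [exact: IH|exact: cT].
elim: n => [|n IH].
  rewrite /ball_n /dist_n; under eq_set do rewrite big_ord0.
  case: (0 < eps); first by rewrite (_ : mkset _ = setT) ?eqEsubset//; exact: openT.
  by rewrite (_ : mkset _ = set0) -?subset0//; exact: open0.
rewrite [X in open X](_ : _ = ball_n T n x eps `&`
    iter n T @^-1` [set y | mdist (iter n T x) y < eps]).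
  by apply: openI => //; apply: open_comp => // y _; exact: cTj.
apply/seteqP; split=> y; rewrite /ball_n /dist_n /=.
  move=> /bigmax_ltP[e0 h]; split; last exact: (h ord_max).
  by apply/bigmax_ltP; split => // j _; exact: (h (widen_ord (leqnSn n) j)).
move=> [/bigmax_ltP[e0 h] hn]; apply/bigmax_ltP; split => // j _.
have := ltn_ord j; rewrite ltnS leq_eqVlt => /predU1P[->//|jn].
exact: (h (Ordinal jn)).
Qed.

Lemma measurable_ball_n n x eps :
  measurable (ball_n T n x eps : set (borel X)).
Proof. by apply: sub_sigma_algebra; exact: ball_n_open. Qed.

Lemma compact_cover_balls (K : set X) n eps : compact K -> 0 < eps ->
  exists s : seq X, forall x, K x -> has (fun y => x \in ball_n T n y eps) s.
Proof.
move=> + e0; rewrite compact_cover => /(_ X setT (fun x => ball_n T n x eps)).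
move=> [x _|x Kx|D _ KD].
- exact: ball_n_open.
- by exists x => //; exact: ball_n_center.
- exists (finmap.enum_fset D) => x /KD[y /= yD xy]; apply/hasP; exists y => //.
  exact/mem_set.
Qed.

End dynamical_balls.

(** * From weighted covers to ordinary covers *)

Section unweighting.
Context {R : realType} {X : pmetricType R}.
Variables (T : X -> X) (K : set X) (eps : R).

(** An index holds the rank [k] of a level and a centre; the length is [m k]. The radius is halved
    because the removal of weights doubles it. *)
Definition level_ball (m : nat -> nat) (i : nat * X) : set X :=
  ball_n T (m i.1) i.2 (eps / 2).

(* A ball of radius [eps / 2] contains at most one point of an [eps]-separated
   set, so such a set inside the region of total weight at least [t] has at most
   (total coefficient) / [t] points. *)
Lemma separated_cover n (l : seq (R * X)) (t : R) : 0 < t ->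
  all (fun ci => 0 <= ci.1) l ->
  exists s : seq X,
    (forall x, K x -> t < total_weight (fun y => ball_n T n y (eps / 2)) l x ->
       exists2 y, y \in s & ball_n T n y eps x) /\
    t * (size s)%:R <= \sum_(ci <- l) ci.1.
Proof.
move=> t0 l0; set tw := total_weight _ l.
pose sep := pairwise (fun x y => eps <= dist_n T n x y).
pose good s := sep s /\ forall x, x \in s -> K x /\ t < tw x.
have goodP s : good s -> t * (size s)%:R <= \sum_(ci <- l) ci.1.
  move=> [ss st].
  apply: (@le_trans _ _ (\sum_(y <- s) tw y)).
    rewrite mulr_natr -sumr_seq_const big_seq [leRHS]big_seq.
    by apply: ler_sum => y /st[_ /ltW].
  (* Double counting: each ball contains at most one point of [s], so its coefficient is counted at
     most once. *)
  rewrite exchange_big/= big_seq [leRHS]big_seq; apply: ler_sum => -[a z] azl /=.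
  rewrite -mulr_sumr ler_piMr//; first exact: (allP l0 _ azl).
  elim: s ss {st} => [|y s IH]; first by rewrite big_nil.
  rewrite /sep pairwise_cons => /andP[/allP ys ss]; rewrite big_cons indicE.
  case: (boolP (y \in _)) => [/set_mem yz|_]; last by rewrite add0r; exact: IH.
  rewrite big_seq big1 ?addr0// => u us; rewrite indicE memNset// => uz.
  have := ys u us; rewrite leNgt => /negP; apply; exact: (ball_n_sub yz uz).
pose P k := `[< exists s, good s /\ size s = k >].
have P0 : exists k, P k by exists 0%N; apply/asboolP; exists [::].
have Pub k : P k -> (k <= (Num.bound ((\sum_(ci <- l) ci.1) / t)))%N.
  move=> /asboolP[s [gs <-]]; rewrite -(ler_nat R); apply: ltW.
  apply: le_lt_trans (archi_boundP _); first by rewrite ler_pdivlMr 1?mulrC ?goodP.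
  rewrite divr_ge0 ?(ltW t0)// big_seq; apply: sumr_ge0 => ci cil.
  exact: (allP l0).
have [k /asboolP[s [[ss st] <-]] smax] := ex_maxnP P0 Pub.
exists s; split; last exact: goodP.
move=> x Kx tx; apply: contrapT => h.
(* A point of [K] with weight above [t] that no [eps]-ball catches could be added to [s], against
   maximality. *)
have : P (size s).+1.
  apply/asboolP; exists (x :: s); split => //; split.
    rewrite /sep pairwise_cons; apply/andP; split; last exact: ss.
    apply/allP => y ys; rewrite leNgt; apply/negP => xy.
    by apply: h; exists y => //; rewrite /ball_n/= dist_n_sym.
  by move=> y; rewrite inE => /predU1P[->//|]; exact: st.
by move=> /smax; rewrite ltnn.
Qed.

(** The thresholds [w k] add up to at most [S / (S + 1) < 1], so each point of [K] has weight above
    [w k] from some level [k], and [separated_cover] applies to that level. The loss [g k * (S + 1)]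
    is absorbed by [g k * b k <= C * a k]. *)
Lemma unweighted_cover (m : nat -> nat) (a b g : nat -> R) (S C : R)
    (l : seq (R * (nat * X))) :
  (forall k, 0 < a k) -> (forall k, 0 < b k) -> (forall k, 0 < g k) -> 0 <= S ->
  (forall N, \sum_(k < N) (g k)^-1 <= S) ->
  (forall k, g k * b k <= C * a k) ->
  nonneg_weights l ->
  (forall x, K x -> 1 <= total_weight (level_ball m) l x) ->
  exists s : seq (nat * X),
    (forall x, K x -> exists2 i, i \in s & ball_n T (m i.1) i.2 eps x) /\
    \sum_(i <- s) b i.1 <= C * (S + 1) * weighted_cost (fun i => a i.1) l.
Proof.
move=> a0 b0 g0 S0 gS gb l0 lK.
pose w k := (g k * (S + 1))^-1.
have S1 : 0 < S + 1 by rewrite ltr_wpDl.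
have w0 k : 0 < w k by rewrite invr_gt0 mulr_gt0.
pose lev k : seq (R * X) := [seq (ci.1, ci.2.2) | ci <- l & ci.2.1 == k].
have lev0 k : all (fun ci => 0 <= ci.1) (lev k).
  apply/allP => _ /mapP[ci + ->] /=; rewrite mem_filter => /andP[_ cil].
  exact: (allP l0).
have /choice[s hs] k := separated_cover (m k) (w0 k) (lev0 k).
pose N := (\max_(ci <- l) ci.2.1).+1.
have lN ci : ci \in l -> (ci.2.1 < N)%N.
  by move=> cil; rewrite ltnS; apply: (@leq_bigmax_seq _ _ xpredT (fun ci => ci.2.1)).
clearbody N.
have split_lev (F : R * (nat * X) -> R) :
    \sum_(ci <- l) F ci = \sum_(k < N) \sum_(ci <- l | ci.2.1 == k) F ci.
  under [RHS]eq_bigr do rewrite big_mkcond/=.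
  rewrite exchange_big/= big_seq [RHS]big_seq; apply: eq_bigr => ci cil.
  rewrite (bigD1 (Ordinal (lN _ cil)))//= eqxx big1 ?addr0// => k kN.
  by rewrite ifF//; apply: contraNF kN => /eqP kE; apply/eqP/val_inj.
exists [seq (k, y) | k <- iota 0 N, y <- s k]; split.
  move=> x Kx; apply: contrapT => nx.
  have : total_weight (level_ball m) l x <= \sum_(k < N) w k.
    rewrite /total_weight split_lev; apply: ler_sum => k _.
    rewrite leNgt; apply/negP => wk; apply: nx.
    have [|y ys xy] := (hs k).1 x Kx.
      apply: lt_le_trans wk _; rewrite /total_weight /lev big_map big_filter.
      by rewrite le_eqVlt; apply/orP; left; apply/eqP; apply: eq_bigr => ci /eqP kE;
         rewrite /level_ball /= kE.
    by exists (nat_of_ord k, y) => //; apply: allpairs_f_dep; rewrite ?mem_iota/=.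
  apply/negP; rewrite -ltNge; apply: lt_le_trans (lK x Kx).
  under eq_bigr do rewrite /w invfM.
  rewrite -mulr_suml ltr_pdivrMr// mul1r.
  by apply: le_lt_trans (gS N) _; rewrite ltrDl.
rewrite big_allpairs_dep/= -[N]subn0 -/(index_iota 0 N) big_mkord.
rewrite /weighted_cost split_lev mulr_sumr; apply: ler_sum => k _.
rewrite sumr_seq_const -[_ *+ _]mulr_natr.
have /= := (hs k).2; rewrite /lev big_map big_filter /w mulrC ler_pdivrMr ?mulr_gt0// => sk.
have -> : \sum_(ci <- l | ci.2.1 == k) ci.1 * a ci.2.1 =
    a k * \sum_(ci <- l | ci.2.1 == k) ci.1.
  by rewrite mulr_sumr; apply: eq_bigr => ci /eqP ->; rewrite mulrC.
apply: le_trans (ler_wpM2l (ltW (b0 k)) sk) _.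
set A := \sum_(_ <- _ | _) _.
have A0 : 0 <= A.
  by rewrite /A big_seq_cond; apply: sumr_ge0 => ci /andP[cil _]; exact: (allP l0).
have -> : b k * (A * (g k * (S + 1))) = (g k * b k) * (A * (S + 1)) by ring.
have -> : C * (S + 1) * (a k * A) = (C * a k) * (A * (S + 1)) by ring.
by apply: ler_wpM2r => //; rewrite mulr_ge0// ltW.
Qed.

End unweighting.

(** * Entropy scales *)

Section extended_real_limits.
Context {R : realType}.
Local Open Scope ereal_scope.
Implicit Types (u : (\bar R)^nat) (c : \bar R).

Lemma ereal_between (x y : \bar R) : x < y -> exists r : R, x < r%:E /\ r%:E < y.
Proof.
case: x => [x| |]; case: y => [y| |]//= xy.
- move: xy; rewrite lte_fin => xy; exists ((x + y) / 2)%R.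
  by rewrite !lte_fin !midf_lt.
- by exists (x + 1)%R; rewrite lte_fin ltrDl ltr01 ltry.
- by exists (y - 1)%R; rewrite lte_fin ltrBlDr ltrDl ltr01 ltNyr.
- by exists 0%R; rewrite ltNyr ltry.
Qed.

Lemma limn_einf_ge u c N :
  (forall n, (N <= n)%N -> c <= u n) -> c <= limn_einf u.
Proof.
move=> cu; rewrite limn_einf_lim (cvg_lim _ (@cvg_einfs_sup _ u))//.
apply: (@le_trans _ _ (einfs u N)); last by apply: ereal_sup_ubound; exists N.
by apply: le_ereal_inf_tmp => _ [n /= Nn <-]; exact: cu.
Qed.

Lemma lt_limn_einf u c :
  c < limn_einf u -> exists N, forall n, (N <= n)%N -> c <= u n.
Proof.
rewrite limn_einf_lim (cvg_lim _ (@cvg_einfs_sup _ u))// => /ereal_sup_gt[_ [N _ <-]].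
move=> cN; exists N => n Nn; apply: (le_trans (ltW cN)).
by apply: ereal_inf_lbound; exists n.
Qed.

Lemma limn_esup_lt u c :
  limn_esup u < c -> exists N, forall n, (N <= n)%N -> u n <= c.
Proof.
rewrite limn_esup_lim (cvg_lim _ (@cvg_esups_inf _ u))// => /ereal_inf_lt[_ [N _ <-]].
move=> Nc; exists N => n Nn; apply: le_trans (ltW Nc).
by apply: ereal_sup_ubound; exists n.
Qed.

Lemma lim_at_right0_sup (F : R -> \bar R) :
  (forall e e', (0 < e)%R -> (e <= e')%R -> F e' <= F e) ->
  lim (F e @[e --> 0^'+]) = ereal_sup [set F e | e in [set e : R | (0 < e)%R]].
Proof.
move=> Fni; rewrite (_ : mkset _ = [set` `]0%R, +oo[]); last first.
  by apply/seteqP; split=> e /=; rewrite in_itv/= andbT.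
apply: cvg_lim => //; apply: nonincreasing_at_right_cvge => //.
by move=> e e'; rewrite in_itv/= andbT => e0 _; exact: Fni.
Qed.

End extended_real_limits.

(** * Consequences of the scaling axioms *)

Section scalings.
Context {R : realType}.
Variable scl : R -> R -> R.
Hypothesis scl_scaling : is_scaling scl.

Lemma scl_exp_gt0 a n : 0 <= a -> (0 < n)%N -> 0 < scl_exp scl a n.
Proof.
case: scl_scaling => + _ _ a0 n0; apply => //.
by rewrite in_itv/= expR_gt0/= expR_lt1 oppr_lt0 ltr0n.
Qed.

Lemma scl_exp_le a m n : 0 <= a -> (0 < m)%N -> (m <= n)%N ->
  scl_exp scl a n <= scl_exp scl a m.
Proof.
case: scl_scaling => _ + _ a0 m0 mn; apply => //.
- by rewrite in_itv/= expR_gt0/= expR_lt1 oppr_lt0 ltr0n (leq_trans m0).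
- by rewrite in_itv/= expR_gt0/= expR_lt1 oppr_lt0 ltr0n.
- by rewrite ler_expR lerN2 ler_nat.
Qed.

(** Some [l > 1] is taken in the first little-o relation, with constant 1. As the [l]-th power of a
    number in (0, 1) is at most that number, monotonicity of [scl b] removes the exponent. *)
Lemma scl_exp_eventually_le a b : 0 < b -> b < a ->
  exists N, forall n, (N <= n)%N -> scl_exp scl a n <= scl_exp scl b n.
Proof.
move=> b0 ba; have [spos shomo /(_ a b b0 ba) slim] := scl_scaling.
have [l [l1 [/eqoP/(_ 1 ltr01) h _]]] :
    exists l : R, 1 < l /\
      ((scl a : R -> R^o) =o_ (0^'+) (fun e => scl b (e `^ l) : R^o) /\
       (scl a : R -> R^o) =o_ (0^'+) (fun e => scl b e `^ l : R^o)).
  have : \forall l \near (1 : R)^'+, 1 < l /\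
      ((scl a : R -> R^o) =o_ (0^'+) (fun e => scl b (e `^ l) : R^o) /\
       (scl a : R -> R^o) =o_ (0^'+) (fun e => scl b e `^ l : R^o)).
    by near=> l; split; [near: l; exact: nbhs_right_gt|near: l].
  exact: filter_ex.
move: h => [r /= r0 hr].
(* The exponential of [n] is at least [1 + n > r^-1], which puts [expR (- n%:R)] below [r]; the
   successor keeps [n] positive. *)
exists (Num.bound r^-1).+1 => n rn.
have n0 : (0 < n)%N by exact: leq_trans rn.
have e0 : 0 < expR (- n%:R) :> R by exact: expR_gt0.
have e1 : expR (- n%:R) < 1 :> R by rewrite expR_lt1 oppr_lt0 ltr0n.
have er : expR (- n%:R) < r.
  rewrite expRN invf_plt ?posrE ?expR_gt0//.
  apply: lt_le_trans (expR_ge1Dx _).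
  apply: (@lt_le_trans _ _ (Num.bound r^-1)%:R).
    by apply: archi_boundP; rewrite invr_ge0 ltW.
  by apply: (@le_trans _ _ n%:R); rewrite ?lerDr// ler_nat ltnW.
have := hr (expR (- n%:R)); rewrite /ball_ /= sub0r normrN gtr0_norm//.
move=> /(_ er e0); rewrite mul1r; set E := expR _ in e0 e1 er *.
have El0 : 0 < E `^ l by exact: powR_gt0.
have ElE : E `^ l <= E by rewrite ge1r_powR ?e0 ?(ltW e1) ?(ltW l1).
have El1 : E `^ l < 1 by exact: le_lt_trans e1.
rewrite /scl_exp -/E ger0_norm; last first.
  by apply/ltW/spos; rewrite ?in_itv/= ?e0// ltW// (lt_trans b0).
rewrite ger0_norm; last first.
  by apply/ltW/spos; rewrite ?in_itv/= ?El0// ltW.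
move=> /le_trans; apply.
by apply: shomo; rewrite ?in_itv/= ?El0 ?e0 ?(ltW b0).
Unshelve. all: by end_near.
Qed.

End scalings.

(** * Entropy scales as suprema and decay conditions *)

Section entropy_scale_values.
Context {R : realType} {X : pmetricType R}.
Variables (T : X -> X) (scl : R -> R -> R).
Hypotheses (cT : continuous T) (scl_scaling : is_scaling scl).
Implicit Types (mu : probability (borel X) R) (K : set X) (a : R).
Local Open Scope ereal_scope.

Lemma bowen_M_eps_N_ge0 a K eps N : (0 <= a)%R ->
  0 <= bowen_M_eps_N T scl a K eps N.
Proof.
move=> a0; apply: le_ereal_inf_tmp => _ [I [n [x [[nN _] ->]]]].
apply: esum_ge0 => i /nN/andP[n0 _].
by rewrite lee_fin ltW// scl_exp_gt0.
Qed.

Lemma bowen_M_eps_N_nondecreasing a K eps :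
  nondecreasing_seq (bowen_M_eps_N T scl a K eps).
Proof.
move=> N N' NN'; apply: le_ereal_inf => _ [I [n [x [[nN KB] ->]]]].
exists I, n, x; split => //; split => // i /nN/andP[-> /=].
exact: leq_trans.
Qed.

Lemma bowen_M_eps_sup a K eps : bowen_M_eps T scl a K eps =
  ereal_sup (range (bowen_M_eps_N T scl a K eps)).
Proof.
apply: cvg_lim => //; apply: ereal_nondecreasing_cvgn.
exact: bowen_M_eps_N_nondecreasing.
Qed.

Lemma bowen_M_sup a K : bowen_M T scl a K =
  ereal_sup [set bowen_M_eps T scl a K e | e in [set e : R | (0 < e)%R]].
Proof.
apply: lim_at_right0_sup => e e' e0 ee'; rewrite !bowen_M_eps_sup.
apply: ge_ereal_sup => _ [N _ <-].
apply: (@le_trans _ _ (bowen_M_eps_N T scl a K e N)); last first.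
  by apply: ereal_sup_ubound; exists N.
apply: le_ereal_inf => _ [I [n [x [[nN KB] ->]]]].
exists I, n, x; split => //; split => //; apply: subset_trans KB _.
by apply: subset_bigcup => i _; exact: subset_ball_n.
Qed.

(** [bowen_M] is a supremum over [eps] and [N] of nonnegative terms. *)
Lemma bowen_M_eq0P a K : (0 <= a)%R -> bowen_M T scl a K = 0 <->
  forall eps N, (0 < eps)%R -> bowen_M_eps_N T scl a K eps N = 0.
Proof.
move=> a0; rewrite bowen_M_sup; split=> [M0 eps N e0|M0].
  apply/eqP; rewrite eq_le bowen_M_eps_N_ge0// andbT -M0.
  apply: (@le_trans _ _ (bowen_M_eps T scl a K eps)).
    by rewrite bowen_M_eps_sup; apply: ereal_sup_ubound; exists N.
  by apply: ereal_sup_ubound; exists eps.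
have Me eps : (0 < eps)%R -> bowen_M_eps T scl a K eps = 0.
  move=> e0; rewrite bowen_M_eps_sup; apply/eqP; rewrite eq_le; apply/andP; split.
    by apply: ge_ereal_sup => _ [N _ <-]; rewrite M0.
  by apply: ereal_sup_ubound; exists 0%N => //; rewrite M0.
apply/eqP; rewrite eq_le; apply/andP; split.
  by apply: ge_ereal_sup => _ [e e0 <-]; rewrite Me.
by apply: ereal_sup_ubound; exists 1%R; rewrite /= ?ltr01// Me.
Qed.

(** Division-free form of the positivity of the lower limit: the quotient is eventually at least
    [c^-1]. *)
Definition mass_decay mu a x eps := exists (c : R) N, (0 < c)%R /\
  forall n, (N <= n)%N -> mu (ball_n T n x eps) <= (c * scl_exp scl a n)%:E.

Lemma mass_decayS mu a x eps eps' : (eps <= eps')%R ->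
  mass_decay mu a x eps' -> mass_decay mu a x eps.
Proof.
move=> ee [c [N [c0 h]]]; exists c, N; split => // n /h; apply: le_trans.
apply: le_measure; rewrite ?inE; [exact: measurable_ball_n..|].
exact: subset_ball_n.
Qed.

Lemma mass_decay_lt mu a b x eps : (0 < b)%R -> (b < a)%R ->
  mass_decay mu a x eps -> mass_decay mu b x eps.
Proof.
move=> b0 ba [c [N [c0 h]]].
have [N' h'] := scl_exp_eventually_le scl_scaling b0 ba.
exists c, (maxn N N'); split => // n; rewrite geq_max => /andP[/h Nn /h' N'n].
by apply: le_trans Nn _; rewrite lee_fin ler_pM2l.
Qed.

Lemma lower_local_eps_at_eq0P mu a x eps : (0 < a)%R ->
  lower_local_eps_at T scl mu a x eps = 0 <-> ~ mass_decay mu a x eps.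
Proof.
move=> a0; rewrite /lower_local_eps_at; set u := fun n => _.
have muE n : exists2 r : R, (0 <= r)%R & mu (ball_n T n x eps) = r%:E.
  have mB := measurable_ball_n cT n x eps.
  exists (fine (mu (ball_n T n x eps))); first exact: fine_ge0.
  by rewrite fineK// fin_num_measure.
(* On a null ball the quotient is [+oo] and the mass bound is trivial, so the equivalence holds
   there too. *)
have le_uP n (c : R) : (0 < c)%R -> (0 < n)%N ->
    (c%:E <= u n) = (mu (ball_n T n x eps) <= (c^-1 * scl_exp scl a n)%:E).
  move=> c0 n0; rewrite /u; have [r r0 ->] := muE n.
  have s0 := scl_exp_gt0 scl_scaling (ltW a0) n0.
  move: r0; rewrite le_eqVlt => /predU1P[<-|r0].
    rewrite inve0 gt0_muley ?lte_fin// leey lee_fin.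
    by rewrite mulr_ge0 ?invr_ge0// ltW.
  rewrite inver gt_eqF// -EFinM !lee_fin ler_pdivlMr//.
  by rewrite [in RHS]mulrC ler_pdivlMr// mulrC.
have u_ge0 : 0 <= limn_einf u.
  apply: (@limn_einf_ge _ _ _ 1%N) => n n0; rewrite /u.
  by rewrite mule_ge0// ?inve_ge0// lee_fin ltW// scl_exp_gt0// ltW.
split=> [u0 [c [N [c0 h]]]|nd].
  suff : (c^-1)%:E <= limn_einf u by rewrite u0 lee_fin leNgt invr_gt0 c0.
  apply: (@limn_einf_ge _ _ _ N.+1) => n Nn.
  by rewrite le_uP ?invr_gt0 ?(leq_trans _ Nn)// invrK h// ltnW.
apply/eqP; rewrite eq_le u_ge0 andbT leNgt; apply/negP => /ereal_between[c [c0 cu]].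
have [N h] := lt_limn_einf cu; apply: nd; rewrite lte_fin in c0.
exists c^-1%R, N.+1; split=> [|n Nn]; first by rewrite invr_gt0.
by rewrite -le_uP ?(leq_trans _ Nn)// h// ltnW.
Qed.

Lemma lower_local_epsE mu x eps : lower_local_eps T scl mu x eps =
  ereal_inf [set a%:E | a in [set a | (0 < a)%R /\ ~ mass_decay mu a x eps]].
Proof.
rewrite /lower_local_eps; congr (ereal_inf (_ @` _)).
by apply/seteqP; split=> a /= [a0] /(lower_local_eps_at_eq0P _ _ _ a0).
Qed.

Lemma lower_local_eps_ge0 mu x eps : 0 <= lower_local_eps T scl mu x eps.
Proof. by apply: le_ereal_inf_tmp => _ [a [/ltW a0 _] <-]; rewrite lee_fin. Qed.

Lemma lower_localE mu x : lower_local T scl mu x =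
  ereal_sup [set lower_local_eps T scl mu x e | e in [set e : R | (0 < e)%R]].
Proof.
apply: lim_at_right0_sup => e e' e0 ee'; rewrite !lower_local_epsE.
apply: le_ereal_inf => _ [a [a0 nd] <-]; exists a => //; split => // nd'.
by apply: nd; exact: mass_decayS nd'.
Qed.

(** * Mass distribution principle *)

Lemma negligible_of_small_covers mu (A : set X) :
  (forall e : R, (0 < e)%R ->
    exists U : set (borel X), [/\ measurable U, A `<=` U & mu U <= e%:E]) ->
  mu.-negligible (A : set (borel X)).
Proof.
move=> h.
have /choice[U hU] k := h k.+1%:R^-1%R (ltac:(by rewrite invr_gt0)).
have mU : measurable (\bigcap_k U k).
  by apply: bigcapT_measurable => k; case: (hU k).
exists (\bigcap_k U k); split => //; last first.
  by move=> x Ax k _; case: (hU k) => _ AU _; exact: AU.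
apply/eqP; rewrite eq_le measure_ge0 andbT; apply/lee_addgt0Pr => e e0.
rewrite add0e; apply: (@le_trans _ _ (mu (U (Num.bound e^-1)))).
  apply: le_measure; rewrite ?inE//; first by case: (hU (Num.bound e^-1)).
  exact: bigcap_inf.
have [_ _ /le_trans] := hU (Num.bound e^-1); apply.
rewrite lee_fin invf_ple ?posrE//.
apply: (@le_trans _ _ (Num.bound e^-1)%:R); last by rewrite ler_nat.
by apply/ltW/archi_boundP; rewrite invr_ge0 ltW.
Qed.

(* Mass distribution principle: a ball of the cover that meets [A] is contained
   in a ball of twice the radius centred in [A], whose mass is controlled. *)
Lemma uniform_decay_negligible mu K a (c eps : R) N : (0 < a)%R ->
  bowen_M T scl a K = 0 -> (0 < c)%R -> (0 < eps)%R ->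
  mu.-negligible ([set x | K x /\ forall n, (N <= n)%N ->
    mu (ball_n T n x eps) <= (c * scl_exp scl a n)%:E] : set (borel X)).
Proof.
move=> a0 /(bowen_M_eq0P _ (ltW a0)) M0 c0 eps0.
set A := mkset _; apply: negligible_of_small_covers => e e0.
(* The radius [eps / 2] will be doubled by recentring; a cost below [e / c] becomes a mass of at
   most [e]. *)
have : bowen_M_eps_N T scl a K (eps / 2) N < (e / c)%:E.
  by rewrite M0 ?divr_gt0// lte_fin divr_gt0.
move=> /ereal_inf_lt[_ [I [n [x [[nN KI] ->]]]] Ilt].
have nI i : I i -> (0 < n i)%N && (N <= n i)%N by exact: nN.
(* [F i] is the recentred ball of radius [eps] if [i] is in [I] and the [i]-th ball meets [A], and
   is empty otherwise. *)
have /choice[F hF] i : exists F : set (borel X), [/\ measurable F,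
    mu F <= (if i \in I then c * scl_exp scl a (n i) else 0)%:E &
    I i -> A `&` ball_n T (n i) (x i) (eps / 2) `<=` F].
  case: (boolP (i \in I)) => [/set_mem Ii|]; last first.
    by rewrite notin_setE => nIi; exists set0; rewrite measure0.
  have /andP[ni0 Nni] := nI i Ii.
  have [[y [Ay xy]]|nA] := pselect (A `&` ball_n T (n i) (x i) (eps / 2) !=set0).
    exists (ball_n T (n i) y eps); split; first exact: measurable_ball_n.
      by apply: Ay.2.
    by move=> _ z [_]; exact: ball_n_sub.
  exists set0; rewrite measure0; split => //.
    by rewrite lee_fin mulr_ge0 ?(ltW c0)// ltW// scl_exp_gt0// ltW.
  by move=> _ z Az; apply: nA; exists z.
exists (\bigcup_i F i); split.
- by apply: bigcup_measurable => i _; case: (hF i).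
- move=> z Az; have [i Ii xz] := KI z Az.1.
  by exists i => //; case: (hF i) => _ _ /(_ Ii); apply; split.
apply: (@le_trans _ _ (\sum_(i <oo) mu (F i))).
  apply: (measure_sigma_subadditive mu) => //.
    by move=> i; case: (hF i).
  by apply: bigcup_measurable => i _; case: (hF i).
have F_ge0 i : 0 <= (if i \in I then c * scl_exp scl a (n i) else 0)%:E.
  by have [_ + _] := hF i; apply: le_trans; exact: measure_ge0.
apply: (@le_trans _ _ (\sum_(i <oo) (if i \in I then c * scl_exp scl a (n i) else 0)%:E)).
  by apply: lee_nneseries => // i _; case: (hF i).
rewrite nneseries_esum// (_ : mkset _ = setT)//; last by apply/seteqP.
pose s i : \bar R := if i \in I then (scl_exp scl a (n i))%:E else 0.
have s_ge0 i : 0 <= s i.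
  rewrite /s; case: ifPn => // /set_mem /nI/andP[ni0 _].
  by rewrite lee_fin ltW// scl_exp_gt0// ltW.
rewrite (eq_esum (b := fun i => c%:E * s i)); last first.
  by move=> i _; rewrite /s; case: ifPn; rewrite ?mule0// EFinM.
rewrite -nneseries_esumT; last first.
  by move=> i; rewrite mule_ge0 ?lee_fin ?(ltW c0).
rewrite nneseriesZl// nneseries_esumT// -esum_mkcond -lee_pdivlMl//.
by apply: le_trans (ltW Ilt) _; rewrite -EFinM lee_fin mulrC.
Qed.

Lemma lower_local_ge0 mu x : 0 <= lower_local T scl mu x.
Proof.
rewrite lower_localE; apply: (le_trans (lower_local_eps_ge0 mu x 1)).
by apply: ereal_sup_ubound; exists 1%R => //=; rewrite ltr01.
Qed.

Lemma lower_local_gtP mu a x : (0 < a)%R -> a%:E < lower_local T scl mu x ->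
  exists2 e : R, (0 < e)%R & mass_decay mu a x e.
Proof.
move=> a0; rewrite lower_localE => /ereal_sup_gt[_ [e e0 <-]].
rewrite lower_local_epsE => ae; exists e => //; apply: contrapT => nd.
by move: ae; apply/negP; rewrite -leNgt; apply: ereal_inf_lbound; exists a.
Qed.

(** Off a negligible set, points lie in [K] and in no [A k], so their local entropy is at most [a].
    The single index [k] bounds radius, constant and starting time together, which leaves a
    countable union. *)
Lemma lower_entropy_le mu K a : measurable (K : set (borel X)) -> mu K = 1 ->
  (0 < a)%R -> bowen_M T scl a K = 0 -> lower_entropy T scl mu <= a%:E.
Proof.
move=> mK muK a0 M0.
pose A k : set (borel X) := [set x | K x /\ forall n, (k.+1 <= n)%N ->
    mu (ball_n T n x k.+1%:R^-1) <= (k.+1%:R * scl_exp scl a n)%:E].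
have nA : mu.-negligible (~` (K : set (borel X)) `|` \bigcup_k A k).
  apply: negligibleU.
    apply/negligibleP; first exact: measurableC.
    by apply: etrans (probability_setC mu mK) _; rewrite muK subee.
  by apply: negligible_bigcup => k; apply: uniform_decay_negligible.
have {}nA : mu.-negligible [set x | ~ lower_local T scl mu x <= a%:E].
  apply: negligibleS nA => x /= /negP; rewrite -ltNge.
  move=> /(lower_local_gtP a0)[e e0 [c [N [c0 h]]]].
  have [Kx|] := pselect (K x); last by left.
  right; pose k := maxn (Num.bound e^-1) (maxn (Num.bound c) N).
  have kge m : (m <= k)%N -> (m%:R <= k.+1%:R :> R)%R.
    by move=> mk; rewrite ler_nat (leq_trans mk).
  exists k => //; split=> // n kn.
  apply: (@le_trans _ _ (mu (ball_n T n x e))).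
    apply: le_measure; rewrite ?inE; [exact: measurable_ball_n..|].
    apply: subset_ball_n => //; rewrite invf_ple ?posrE//.
    apply: le_trans (kge (Num.bound e^-1) _); last by rewrite leq_max leqnn.
    by apply/ltW/archi_boundP; rewrite invr_ge0 ltW.
  apply: le_trans (h n _) _.
    by apply: leq_trans (ltnW kn); rewrite !leq_max leqnn !orbT.
  rewrite lee_fin ler_wpM2r//.
    by rewrite ltW// scl_exp_gt0// ?(ltW a0)// (leq_trans _ kn).
  apply: le_trans (kge (Num.bound c) _); last by rewrite !leq_max leqnn orbT.
  by apply/ltW/archi_boundP/ltW.
(* The integral is a supremum over simple functions [h] below [lower_local]; each is measurable and
   almost everywhere at most [a]. *)
rewrite /lower_entropy ge0_integralTE; last by move=> x; exact: lower_local_ge0.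
apply: ge_ereal_sup => _ [h hl <-]; rewrite -integralT_nnsfun.
apply: (@le_trans _ _ (\int[mu]_x (cst a%:E x))).
  apply: ae_ge0_le_integral => //.
  - by move=> x _; rewrite lee_fin; exact: fun_ge0.
  - exact/measurable_realfun.measurable_EFinP.
  - by move=> x _; rewrite lee_fin ltW.
  - apply: negligibleS nA => x /= h1 h2; apply: h1 => _.
    exact: le_trans (hl x) h2.
rewrite integral_cst; last exact: measurableT.
by rewrite [X in _ * X](_ : _ = 1) ?mule1//; exact: (probability_setT mu).
Qed.

(** * Frostman-type measures *)

Lemma bowen_M_eps_N_le_sum a K eps N (s : seq (nat * X)) : (0 <= a)%R ->
  (forall i, i \in s -> (0 < i.1)%N && (N <= i.1)%N) ->
  (forall x, K x -> exists2 i, i \in s & ball_n T i.1 i.2 eps x) ->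
  bowen_M_eps_N T scl a K eps N <= (\sum_(i <- s) scl_exp scl a i.1)%:E.
Proof.
move=> a0 sN Ks; pose i0 : nat * X := (1%N, point).
have sn j : (j < size s)%N -> nth i0 s j \in s by exact: mem_nth.
apply: ereal_inf_lbound.
exists `I_(size s), (fun j => (nth i0 s j).1), (fun j => (nth i0 s j).2); split.
  split=> [j /sn /sN //|x /Ks[i is_ xi]].
  by exists (index i s); rewrite /= ?index_mem// nth_index.
rewrite esum_fset//; last first.
  move=> j /set_mem /sn /sN /andP[j0 _].
  by rewrite lee_fin ltW// scl_exp_gt0.
by rewrite -fsbig_ord sumEFin (big_nth i0) big_mkord.
Qed.

(** Decay at [a] entails decay at every smaller positive [b], so the constant [a] is a simple
    function below [lower_local]. *)
Lemma lower_entropy_ge mu a eps : (0 < a)%R -> (0 < eps)%R ->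
  (forall x, mass_decay mu a x eps) -> a%:E <= lower_entropy T scl mu.
Proof.
move=> a0 eps0 md; rewrite /lower_entropy ge0_integralTE; last first.
  by move=> x; exact: lower_local_ge0.
apply: ereal_sup_ubound.
exists (cst_nnsfun (borel X) (NngNum (ltW a0))); last first.
  have := sintegral_EFin_cst mu setT (NngNum (ltW a0)).
  rewrite patch_setT => ->; rewrite [X in _ * X](_ : _ = 1) ?mule1//.
  exact: (probability_setT mu).
move=> x /=; apply: (@le_trans _ _ (lower_local_eps T scl mu x eps)).
  rewrite lower_local_epsE; apply: le_ereal_inf_tmp => _ [b [b0 nd] <-].
  rewrite lee_fin leNgt; apply/negP => ba; apply: nd.
  exact: mass_decay_lt (md x).
by rewrite lower_localE; apply: ereal_sup_ubound; exists eps.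
Qed.

Lemma compact_measurable K : compact K -> measurable (K : set (borel X)).
Proof.
move=> cK; rewrite -[K]setCK; apply: measurableC; apply: sub_sigma_algebra.
by apply: closed_openC; apply: compact_closed => //; exact: metric_hausdorff.
Qed.

(* Only the balls of levels [m k] enter the weighted covers, so only their mass
   is controlled directly; the bound on consecutive ratios fills the gaps. *)
Lemma frostman_measure K (a b eps S L C : R) (m : nat -> nat) (g : nat -> R) :
  compact [set: X] -> compact K -> (0 < a)%R -> (0 < b)%R -> (0 < eps)%R ->
  (forall k, (0 < m k)%N && (m k < m k.+1)%N) ->
  (forall k, (0 < g k)%R) -> (0 <= S)%R -> (0 < L)%R -> (0 < C)%R ->
  (forall N, (\sum_(k < N) (g k)^-1 <= S)%R) ->
  (forall k, (g k * scl_exp scl b (m k) <= L * scl_exp scl a (m k))%R) ->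
  (forall k, (scl_exp scl a (m k) / scl_exp scl a (m k.+1) <= C)%R) ->
  bowen_M_eps_N T scl b K eps (m 0%N) != 0 ->
  exists mu, mu K = 1 /\ forall x, mass_decay mu a x (eps / 2).
Proof.
move=> cX cK a0 b0 eps0 mS g0 S0 L0 C0 gS gb ratio M_neq0.
have m_gt0 k : (0 < m k)%N by have /andP[] := mS k.
have m_mono : {homo m : i j / (i <= j)%N}.
  by apply: homo_leq => // [|k]; [exact: leq_trans|have /andP[_ /ltnW] := mS k].
have m_ge k : (k <= m k)%N.
  by elim: k => // k IH; apply: leq_ltn_trans IH _; have /andP[] := mS k.
have [eta [eta0 etaM]] : exists eta : R, 0 < eta%:E /\
    eta%:E < bowen_M_eps_N T scl b K eps (m 0%N).
  by apply: ereal_between; rewrite lt_def M_neq0 bowen_M_eps_N_ge0// ltW.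
rewrite lte_fin in eta0.
have S1 : (0 < S + 1)%R by rewrite ltr_wpDl.
(* Ordinary covers cost more than [eta] and [unweighted_cover] loses the factor [L * (S + 1)], so
   weighted covers cost at least [c]. *)
pose c := (eta / (L * (S + 1)))%R.
have c0 : (0 < c)%R by rewrite divr_gt0// mulr_gt0.
pose w (i : nat * X) := scl_exp scl a (m i.1).
have c_le l : nonneg_weights l ->
    (forall x, K x -> (1 <= total_weight (level_ball T eps m) l x)%R) ->
    (c <= weighted_cost w l)%R.
  move=> l0 lK.
  have [//|//|s [Ks sl]] := unweighted_cover (a := fun k => scl_exp scl a (m k))
    (b := fun k => scl_exp scl b (m k)) _ _ g0 S0 gS gb l0 lK.
  - by move=> k; rewrite scl_exp_gt0// ltW.
  - by move=> k; rewrite scl_exp_gt0// ltW.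
  rewrite ler_pdivrMr ?mulr_gt0// mulrC; apply: le_trans sl.
  rewrite -lee_fin; apply: le_trans (ltW etaM) _.
  have := @bowen_M_eps_N_le_sum b K eps (m 0%N) [seq (m i.1, i.2) | i <- s] (ltW b0).
  rewrite big_map; apply.
    by move=> _ /mapP[i _ ->] /=; rewrite m_gt0/= m_mono.
  move=> x /Ks[i is_ xi]; exists (m i.1, i.2) => //.
  by apply/mapP; exists i.
have eps20 : (0 < eps / 2)%R by rewrite divr_gt0.
(* Finitely many balls of the first level cover [K], as [content_of_weighted_cover] requires. *)
have [s0 Ks0] := compact_cover_balls cT (m 0%N) cK eps20.
have Ks x : K x -> has (fun i => x \in level_ball T eps m i) [seq (0%N, y) | y <- s0].
  by move=> /Ks0; rewrite has_map.
have w0 i : (0 <= w i)%R by rewrite ltW// scl_exp_gt0// ltW.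
have [lam [lam0 lamU lamT lamK lamw]] := content_of_weighted_cover w0 Ks c0 c_le.
have [mu [muo muc]] :=
  borel_probability_of_content cX (@metric_hausdorff _ X) lam0 lamU lamT.
have clK : closed K by apply: compact_closed => //; exact: metric_hausdorff.
exists mu; split.
  apply/eqP; rewrite eq_le probability_le1//=; last exact: compact_measurable.
  have lamK1 : lam K = 1%R.
    by have := lamU K (~` K) (setICr K); rewrite setUCr lamT lamK addr0.
  by rewrite -[leLHS]/(1%R%:E) -lamK1; exact: muc.
move=> x; exists (C / c)%R, (m 0%N); split=> [|n mn]; first by rewrite divr_gt0.
(* [k] is the last level with [m k <= n]: the ball of length [n] lies in the one of length [m k],
   and [ratio] compares the scale at [m k] with the one at [m k.+1], hence with the larger one at
   [n]. *)
have [k [mk nk]] : exists k, (m k <= n)%N /\ (n < m k.+1)%N.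
  have Pub k : (m k <= n)%N -> (k <= n)%N by exact: leq_trans.
  have [k mk kmax] := ex_maxnP (ex_intro (fun k => m k <= n)%N 0%N mn) Pub.
  by exists k; split => //; rewrite ltnNge; apply/negP => /kmax; rewrite ltnn.
apply: (@le_trans _ _ (mu (ball_n T (m k) x (eps / 2)))).
  by apply: le_measure; rewrite ?inE; [exact: measurable_ball_n..|exact: subset_ball_n].
apply: le_trans (muo _ (ball_n_open cT (m k) x (eps / 2))) _.
rewrite lee_fin; apply: le_trans (lamw (k, x)) _.
rewrite /w/= mulrAC ler_pM2r ?invr_gt0//.
have sk := scl_exp_gt0 scl_scaling (ltW a0) (m_gt0 k.+1).
move: (ratio k); rewrite ler_pdivrMr// => /le_trans; apply.
rewrite ler_pM2l//; apply: scl_exp_le; rewrite ?(ltW a0)//.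
  exact: leq_trans (m_gt0 0%N) mn.
exact: ltnW.
Qed.

(** * The two inequalities *)

Lemma sup_lower_entropy_ge0 K : K !=set0 -> compact K ->
  0 <= sup_lower_entropy T scl K.
Proof.
move=> [x Kx] cK.
(* A Dirac mass at a point of [K] shows that the supremum is not over the empty set. *)
have [mu muK] : exists mu, mu K = 1.
  by exists \d_(x : borel X); rewrite /= diracE mem_set.
apply: (@le_trans _ _ (lower_entropy T scl mu)).
  by apply: integral_ge0 => y _; exact: lower_local_ge0.
by apply: ereal_sup_ubound; exists mu.
Qed.

Lemma sup_lower_entropy_le K : compact K ->
  sup_lower_entropy T scl K <= bowen_entropy T scl K.
Proof.
move=> cK; apply: ge_ereal_sup => _ [mu muK <-].
have mK := compact_measurable cK.
apply: le_ereal_inf_tmp => _ [a [a0 Ma] <-].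
exact: lower_entropy_le Ma.
Qed.

(** A real [a] strictly between the two sides would be at most the entropy of some measure carried
    by [K], a contradiction. *)
Lemma bowen_entropy_le_sup K : compact [set: X] -> controlled_decay scl ->
  K !=set0 -> compact K ->
  bowen_entropy T scl K <= sup_lower_entropy T scl K.
Proof.
move=> cX cd K0 cK; rewrite leNgt; apply/negP => /ereal_between[a [Sa ah]].
have a0 : (0 < a)%R.
  by rewrite -lte_fin; apply: le_lt_trans Sa; exact: sup_lower_entropy_ge0.
move: Sa; apply/negP; rewrite -leNgt.
have [h [ah' hh]] := ereal_between ah; rewrite lte_fin in ah'.
have [f [n [C [data [cvgL limL]]]]] := cd a (ltW a0).
set L := fun d : R => _ in cvgL limL.
have [d [[fpos nmono C1 fsum ratio] [Ld [d0 dh]]]] : exists d : R,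
    [/\ forall m, (0 < m)%N -> (0 < f d m)%R,
        forall k, (0 < n d k)%N && (n d k < n d k.+1)%N,
        (1 <= C d)%R,
        (\sum_(0 <= k <oo) ((f d (n d k))^-1)%:E < +oo)%E
      & forall k, (scl_exp scl a (n d k) / scl_exp scl a (n d k.+1) <= C d)%R] /\
    L d < +oo /\ (0 < d)%R /\ (d < h - a)%R.
  apply: (@filter_ex _ (0%R : R)^'+).
  (* A limit below [+oo] forces [L d < +oo] for small [d]. *)
  have Lnear : \forall d \near (0%R : R)^'+, L d < +oo.
    apply: (cvgL [set z | z < +oo]); apply: open_nbhs_nbhs; split => //.
    exact: open_ereal_lt_ereal.
  near=> d; split; first by near: d.
  split; first by near: d.
  split; near: d; first exact: nbhs_right_gt.
  by apply: nbhs_right_lt; rewrite subr_gt0.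
have [y [Ly _]] := ereal_between Ld.
have [N1 hN1] := limn_esup_lt Ly.
have ad0 : (0 < a + d)%R by rewrite addr_gt0.
(* [a + d < h] lies below the infimum of the exponents at which [bowen_M] vanishes. *)
have [eps [N2 [eps0 M_neq0]]] : exists eps N, (0 < eps)%R /\
    bowen_M_eps_N T scl (a + d) K eps N != 0.
  apply: contrapT => nM; suff : bowen_M T scl (a + d) K = 0.
    move=> M0; move: hh; apply/negP; rewrite -leNgt.
    apply: (@le_trans _ _ (a + d)%:E); last by rewrite lee_fin -lerBrDl ltW.
    by apply: ereal_inf_lbound; exists (a + d)%R.
  apply/(bowen_M_eq0P _ (ltW ad0)) => eps N eps0; apply/eqP/negPn/negP => M.
  by apply: nM; exists eps, N.
(* The levels before [k0] are dropped: from [N1] on the bound [y] on the quotients holds, and from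
   [N2] on the lengths are at least [N2]. *)
pose k0 := maxn N1 N2; pose m k := n d (k0 + k)%N.
have n_ge k : (k <= n d k)%N.
  by elim: k => // k IH; apply: leq_ltn_trans IH _; have /andP[] := nmono k.
have n_gt0 k : (0 < n d k)%N by have /andP[] := nmono k.
have fV_ge0 k : (0 <= (f d (n d k))^-1)%R by rewrite invr_ge0 ltW// fpos.
pose S := fine (\sum_(0 <= k <oo) ((f d (n d k))^-1)%:E).
have sum_ge0 : 0 <= \sum_(0 <= k <oo) ((f d (n d k))^-1)%:E.
  by apply: nneseries_ge0 => k _ _; rewrite lee_fin.
have SE : S%:E = \sum_(0 <= k <oo) ((f d (n d k))^-1)%:E.
  by rewrite fineK// ge0_fin_numE.
have [mu [muK md]] : exists mu, mu K = 1 /\ forall x, mass_decay mu a x (eps / 2).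
  (* The maximum with 1 makes the constant positive. *)
  apply: (@frostman_measure K a (a + d)%R eps S (Num.max y 1)%R (C d) m
    (fun k => f d (m k))) => //.
  - by move=> k; rewrite /m addnS.
  - by move=> k; apply: fpos; exact: n_gt0.
  - exact: fine_ge0.
  - by rewrite lt_max ltr01 orbT.
  - exact: lt_le_trans C1.
  - move=> N; rewrite -lee_fin SE.
    apply: le_trans (@nneseries_lim_ge _ _ xpredT 0%N (k0 + N)%N _); last first.
      by move=> k _ _; rewrite lee_fin.
    rewrite sumEFin lee_fin big_mkord big_split_ord/= lerDr.
    by apply: sumr_ge0.
  - move=> k; have sa := scl_exp_gt0 scl_scaling (ltW a0) (n_gt0 (k0 + k)%N).
    have := hN1 (k0 + k)%N (leq_trans (leq_maxl _ _) (leq_addr _ _)).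
    rewrite lee_fin ler_pdivrMr// => /le_trans; apply.
    by rewrite ler_wpM2r ?(ltW sa)// le_max lexx.
  - by move=> k; rewrite /m addnS.
  - have N2m : (N2 <= m 0%N)%N.
      by rewrite /m addn0; apply: leq_trans (n_ge _); rewrite leq_max leqnn orbT.
    apply: contra_neq M_neq0 => M0; apply/eqP.
    rewrite eq_le bowen_M_eps_N_ge0 ?(ltW ad0)// andbT.
    by rewrite -M0; exact: bowen_M_eps_N_nondecreasing.
apply: (@le_trans _ _ (lower_entropy T scl mu)).
  by apply: (@lower_entropy_ge mu a (eps / 2)%R) => //; rewrite divr_gt0.
by apply: ereal_sup_ubound; exists mu.
Unshelve. all: by end_near.
Qed.

End entropy_scale_values.

Theorem theorem1p1 (R : realType) (X : pmetricType R) (T : X -> X)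
    (scl : R -> R -> R) :
  compact [set: X] -> continuous T -> is_scaling scl ->
  (forall K : set X, K !=set0 -> compact K ->
     (sup_lower_entropy T scl K <= bowen_entropy T scl K)%E) /\
  (controlled_decay scl ->
   forall K : set X, K !=set0 -> compact K ->
     bowen_entropy T scl K = sup_lower_entropy T scl K).
Proof.
move=> cX cT hscl; split=> [K _ cK|cd K K0 cK]; first exact: sup_lower_entropy_le.
by apply/eqP; rewrite eq_le bowen_entropy_le_sup//= sup_lower_entropy_le.
Qed.
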